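(* For any multi-index $\alpha$ there exists a positive constant $C$, independent of $\xi$ and $t$, such that for all $\xi\in\mathbb R^3\setminus\{0\}$ and $t>0$, $$\big|D^\alpha_\xi\widehat{\mathcal G}(\xi,t)\big|\le Ce^{-\frac13|\xi|^2t}|\xi|^{-|\alpha|}.$$
   Context: $\widehat{\mathcal G}(\xi,t)$ is the Fourier transform of the Green matrix of the linear system $\partial_tu_A-\Delta u_A-\Lambda\omega_\Omega=0$, $\partial_t\omega_\Omega-\Delta\omega_\Omega+2\omega_\Omega-\Lambda u_A=0$ on $\mathbb R^3$ (with $\Lambda=\mathcal F^{-1}|\xi|\mathcal F$), namely the $2\times2$ matrix $$\widehat{\mathcal G}(\xi,t)=e^{-|\xi|^2t}\Big(\mathcal A(\xi,t)\begin{pmatrix}-1&-|\xi|\\-|\xi|&1\end{pmatrix}+\mathcal B(\xi,t)I\Big),$$ $$\mathcal A(\xi,t)=\frac{e^{(-1-\sqrt{1+|\xi|^2})t}-e^{(-1+\sqrt{1+|\xi|^2})t}}{2\sqrt{1+|\xi|^2}},\qquad \mathcal B(\xi,t)=\frac{e^{(-1-\sqrt{1+|\xi|^2})t}+e^{(-1+\sqrt{1+|\xi|^2})t}}2.$$ For a matrix $M=(M_{ij})$, $|M|=\sum_{i,j}|M_{ij}|$. *)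

(* Defs.v *)
From HB Require Import structures.
From mathcomp Require Import all_boot all_order all_algebra.
From mathcomp Require Import all_classical all_reals all_analysis.
Import Order.TTheory GRing.Theory Num.Theory.
Import numFieldNormedType.Exports.

Set Implicit Arguments.
Unset Strict Implicit.
Unset Printing Implicit Defensive.

Local Open Scope ring_scope.

(* The library norm `|x| on row vectors is the sup norm; this is the Euclidean
   norm. *)
Definition enorm (R : realType) (n : nat) (x : 'rV[R]_n) : R :=
  Num.sqrt (\sum_(i < n) x ord0 i ^+ 2).

Definition mnorm1 (R : realType) (m n : nat) (M : 'M[R]_(m, n)) : R :=
  \sum_(i < m) \sum_(j < n) `|M i j|.

Definition partial (R : realType) (n : nat) (W : normedModType R) (i : 'I_n)
    (f : 'rV[R]_n -> W) : 'rV[R]_n -> W :=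
  fun x => 'D_(delta_mx ord0 i) f x.

Definition multi_index (n : nat) := {ffun 'I_n -> nat}.

Definition mi_order (n : nat) (alpha : multi_index n) : nat :=
  (\sum_(i < n) alpha i)%N.

(* D^alpha f = d_0^{alpha_0} (d_1^{alpha_1} (... f)).  The library's 'D_v is
   total; the functions differentiated below are smooth in xi away from 0, so
   there these are genuine derivatives. *)
Definition Dmulti (R : realType) (n : nat) (W : normedModType R)
    (alpha : multi_index n) (f : 'rV[R]_n -> W) : 'rV[R]_n -> W :=
  foldr (fun i g => iter (alpha i) (partial i) g) f (enum 'I_n).

Section GreenMatrix.
Variable R : realType.
Implicit Types (xi : 'rV[R]_3) (t : R).

Definition calA xi t : R :=
  let s := Num.sqrt (1 + enorm xi ^+ 2) in
  (expR ((- 1 - s) * t) - expR ((- 1 + s) * t)) / (2 * s).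

Definition calB xi t : R :=
  let s := Num.sqrt (1 + enorm xi ^+ 2) in
  (expR ((- 1 - s) * t) + expR ((- 1 + s) * t)) / 2.

(* The matrix (-1, -|xi|; -|xi|, 1). *)
Definition Jmx xi : 'M[R]_2 :=
  \matrix_(i < 2, j < 2)
    if i == j then (if i == ord0 then - 1 else 1) else - enorm xi.

Definition Ghat xi t : 'M[R]_2 :=
  expR (- (enorm xi ^+ 2 * t)) *: (calA xi t *: Jmx xi + calB xi t *: 1%:M).

End GreenMatrix.

(* Main.v *)
(* Write r = |xi| and s = sqrt (1 + r^2).  The entries of the Green matrix are
   combinations of the exponentials e^(lambda t), lambda = -r^2 - 1 -+ s, with
   coefficients polynomial in r and 1/s.  Both lambda are at most -r^2/2, since
   s <= 1 + r^2/2.  Give the letters xi_i, r, 1/r, 1/s, t the orders 1, 1, -1,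
   0 or -1, -2.  Differentiation in xi lowers the order of a polynomial in these
   letters by one, and so does multiplication by t (d_i lambda), which is what
   differentiating the exponential produces.  A polynomial of order m is
   O((1 + r^2 t)^k r^m), and e^(-r^2 t/2) absorbs (1 + r^2 t)^k at the cost of
   weakening the exponent to -r^2 t/3. *)
Require Import Defs.
From HB Require Import structures.
From mathcomp Require Import all_boot all_order all_algebra.
From mathcomp Require Import all_classical all_reals all_analysis.
From mathcomp Require Import ring lra zify.
Import Order.TTheory GRing.Theory Num.Theory.
Import numFieldNormedType.Exports.

Set Implicit Arguments.
Unset Strict Implicit.
Unset Printing Implicit Defensive.

Local Open Scope ring_scope.

(** * Calculus of directional derivatives of scalar functions *)

Section DirectionalDerivatives.
Variables (R : realType) (V : normedModType R).

(** Both sides have the same difference quotient. Restricting to a line gives a chain rule for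
    directional derivatives from the one-variable one. *)
Lemma is_derive_line (f : V -> R) (x v : V) (df : R) :
  is_derive x v f df <-> is_derive (0 : R) (1 : R) (fun h => f (h *: v + x)) df.
Proof.
have E : (fun h : R => h^-1 *: (f (h *: v + x) - f x)) =
    (fun h : R => h^-1 *: (f ((h *: (1 : R) + 0) *: v + x) - f (0 *: v + x))).
  by apply/funext => h; rewrite addr0 scale0r add0r [_%:A]mulr1.
split=> -[df1 df2]; apply: DeriveDef.
- by move/derivable1P: df1.
- by rewrite -df2 /derive E.
- by apply/derivable1P.
- by rewrite -df2 /derive E.
Qed.

Lemma is_derive_chain (f : R -> R) (g : V -> R) (x v : V) (a b : R) :
  is_derive (g x) 1 f a -> is_derive x v g b ->
  is_derive x v (fun y => f (g y)) (a * b).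
Proof.
move=> df /is_derive_line dg; apply/is_derive_line.
by apply: is_derive1_comp dg; rewrite scale0r add0r.
Qed.

Lemma is_derive_mul (f g : V -> R) (x v : V) (a b : R) :
  is_derive x v f a -> is_derive x v g b ->
  is_derive x v (fun y => f y * g y) (f x * b + g x * a).
Proof. by move=> df dg; exact: (is_deriveM df dg). Qed.

Lemma is_derive_add (f g : V -> R) (x v : V) (a b : R) :
  is_derive x v f a -> is_derive x v g b ->
  is_derive x v (fun y => f y + g y) (a + b).
Proof. by move=> df dg; exact: (is_deriveD df dg). Qed.

Lemma is_derive_inv (f : V -> R) (x v : V) (a : R) :
  f x != 0 -> is_derive x v f a ->
  is_derive x v (fun y => (f y)^-1) (- (f x) ^- 2 * a).
Proof.
move=> fx0 [df <-]; apply: DeriveDef; first exact: derivableV.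
exact: deriveV.
Qed.

End DirectionalDerivatives.

(** * The Euclidean norm, the bracket [japanese], and their derivatives *)

Section Symbols.
Variables (R : realType) (n : nat).
Implicit Types (x : 'rV[R]_n) (t : R) (m : int) (i : 'I_n).

Local Notation e_ i := (delta_mx ord0 i : 'rV[R]_n).

Lemma enorm_sqr x : enorm x ^+ 2 = \sum_(i < n) x ord0 i ^+ 2.
Proof. by rewrite sqr_sqrtr// sumr_ge0// => i _; rewrite sqr_ge0. Qed.

Lemma enorm_ge0 x : 0 <= enorm x. Proof. exact: sqrtr_ge0. Qed.

Lemma enorm_gt0 x : x != 0 -> 0 < enorm x.
Proof.
move=> x0; rewrite lt_neqAle enorm_ge0 andbT eq_sym.
apply: contra x0; rewrite -sqrf_eq0 enorm_sqr psumr_eq0; last first.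
  by move=> i _; rewrite sqr_ge0.
move=> /allP x0; apply/eqP/rowP => i; rewrite mxE.
by have := x0 i (mem_index_enum i); rewrite sqrf_eq0 => /eqP.
Qed.

Lemma coord_le_enorm x i : `|x ord0 i| <= enorm x.
Proof.
rewrite -sqrtr_sqr ler_wsqrtr// (bigD1 i)//= lerDl sumr_ge0// => j _.
exact: sqr_ge0.
Qed.

(** The root [s] of [calA] and [calB]. *)
Definition japanese x : R := Num.sqrt (1 + enorm x ^+ 2).

Lemma japanese_sqr x : japanese x ^+ 2 = 1 + enorm x ^+ 2.
Proof. by rewrite sqr_sqrtr// addr_ge0// sqr_ge0. Qed.

Lemma japanese_ge1 x : 1 <= japanese x.
Proof. by rewrite -[leLHS]sqrtr1 ler_wsqrtr// lerDl sqr_ge0. Qed.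

Lemma japanese_gt0 x : 0 < japanese x.
Proof. exact: lt_le_trans (japanese_ge1 x). Qed.

Lemma enorm_le_japanese x : enorm x <= japanese x.
Proof.
by rewrite -[leLHS]ger0_norm ?enorm_ge0// -sqrtr_sqr ler_wsqrtr// lerDr.
Qed.

Lemma is_derive_coord x (i j : 'I_n) :
  is_derive x (e_ i) (fun y => y ord0 j) (j == i)%:R.
Proof.
apply/is_derive_line.
have -> : (fun h : R => (h *: e_ i + x) ord0 j) =
          (fun h : R => h * (j == i)%:R + x ord0 j).
  by apply/funext => h; rewrite !mxE eqxx.
have D := is_derive_add (is_derive_mul (is_derive_id (0 : R) (1 : R))
  (is_derive_cst ((j == i)%:R : R) _ _)) (is_derive_cst (x ord0 j) _ _).
by apply: (is_derive_eq D); rewrite mulr0 add0r mulr1 addr0.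
Qed.

Lemma is_derive_enorm_sqr x i :
  is_derive x (e_ i) (fun y => enorm y ^+ 2) (2 * x ord0 i).
Proof.
have -> : (fun y : 'rV[R]_n => enorm y ^+ 2) =
          \sum_(j < n) (fun y : 'rV[R]_n => y ord0 j * y ord0 j).
  by apply/funext => y; rewrite enorm_sqr fct_sumE.
have D := is_derive_sum (fun j =>
  is_derive_mul (is_derive_coord x i j) (is_derive_coord x i j)).
apply: (is_derive_eq D).
rewrite (bigD1 i)//= eqxx big1 => [|j /negPf ->]; last by rewrite mulr0 addr0.
by rewrite mulr1 addr0 mulr2n mulrDl mul1r.
Qed.

Lemma is_derive_enorm x i : x != 0 ->
  is_derive x (e_ i) (@enorm R n) (x ord0 i * (enorm x)^-1).
Proof.
move=> x0; have r0 := enorm_gt0 x0.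
have -> : @enorm R n = (fun y => Num.sqrt (enorm y ^+ 2)).
  by apply/funext => y; rewrite sqrtr_sqr ger0_norm// enorm_ge0.
have D := is_derive_chain (g := fun y => enorm y ^+ 2)
  (is_derive1_sqrt (exprn_gt0 2 r0)) (is_derive_enorm_sqr x i).
apply: (is_derive_eq D).
rewrite sqrtr_sqr ger0_norm ?enorm_ge0//; field.
by rewrite gt_eqF.
Qed.

Lemma is_derive_japanese x i :
  is_derive x (e_ i) japanese (x ord0 i * (japanese x)^-1).
Proof.
have j0 : 0 < 1 + enorm x ^+ 2 by rewrite ltr_pwDl// sqr_ge0.
have D := is_derive_chain (g := fun y => 1 + enorm y ^+ 2) (is_derive1_sqrt j0)
  (is_derive_add (is_derive_cst (1 : R) x _) (is_derive_enorm_sqr x i)).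
apply: (is_derive_eq D); rewrite -/(japanese x); field.
by rewrite gt_eqF// japanese_gt0.
Qed.

Lemma is_derive_japaneseV x i :
  is_derive x (e_ i) (fun y => (japanese y)^-1)
    (- 1 * x ord0 i * (japanese x)^-1 * (japanese x)^-1 * (japanese x)^-1).
Proof.
have j0 := lt0r_neq0 (japanese_gt0 x).
by apply: (is_derive_eq (is_derive_inv j0 (is_derive_japanese x i))); field.
Qed.

(** * Symbols: differentiation and growth *)

(* The order counts powers of |x|, with t counted as |x|^-2.  [1 / japanese] has
   two orders because its derivative [- x_i / japanese^3] has order -1 only if
   two of the three factors are estimated by [1 / |x|]. *)
Inductive symbol : int -> ('rV[R]_n -> R -> R) -> Prop :=
| symbol_0 m : symbol m (fun _ _ => 0)
| symbol_cst c : symbol 0 (fun _ _ => c)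
| symbol_coord i : symbol 1 (fun x _ => x ord0 i)
| symbol_enorm : symbol 1 (fun x _ => enorm x)
| symbol_enormV : symbol (- 1) (fun x _ => (enorm x)^-1)
| symbol_japaneseV0 : symbol 0 (fun x _ => (japanese x)^-1)
| symbol_japaneseV1 : symbol (- 1) (fun x _ => (japanese x)^-1)
| symbol_time : symbol (- 2) (fun _ t => t)
| symbol_add m f g : symbol m f -> symbol m g ->
    symbol m (fun x t => f x t + g x t)
| symbol_mul m1 m2 f g : symbol m1 f -> symbol m2 g ->
    symbol (m1 + m2) (fun x t => f x t * g x t).

(** Leaves the sum of orders as an equation to be checked, since a prescribed order rarely has the
    literal form [m1 + m2]. *)
Lemma symbol_mul_eq m m1 m2 f g : symbol m1 f -> symbol m2 g ->
  m = m1 + m2 -> symbol m (fun x t => f x t * g x t).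
Proof. by move=> sf sg ->; exact: symbol_mul. Qed.

Lemma symbol_derive i m f : symbol m f ->
  exists2 g, symbol (m - 1) g & forall x t, x != 0 ->
    is_derive x (e_ i) (f^~ t) (g x t).
Proof.
elim=> {m f}.
- move=> m; exists (fun _ _ => 0); first exact: symbol_0.
  by move=> x t _; exact: is_derive_cst.
- move=> c; exists (fun _ _ => 0); first exact: symbol_0.
  by move=> x t _; exact: is_derive_cst.
- move=> j; exists (fun _ _ => (j == i)%:R); first exact: symbol_cst.
  by move=> x t _; exact: is_derive_coord.
- exists (fun x _ => x ord0 i * (enorm x)^-1).
    by apply: symbol_mul_eq (symbol_coord _) symbol_enormV _.
  by move=> x t x0; exact: is_derive_enorm.
- exists (fun x _ =>
      - 1 * x ord0 i * (enorm x)^-1 * (enorm x)^-1 * (enorm x)^-1).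
    apply: (@symbol_mul_eq _ (- 1) (- 1)) => //; last exact: symbol_enormV.
    apply: (@symbol_mul_eq _ 0 (- 1)) => //; last exact: symbol_enormV.
    apply: (@symbol_mul_eq _ 1 (- 1)) => //; last exact: symbol_enormV.
    exact: (@symbol_mul_eq _ 0 1 _ _ (symbol_cst _) (symbol_coord _)).
  move=> x t x0; have r0 := lt0r_neq0 (enorm_gt0 x0).
  by apply: (is_derive_eq (is_derive_inv r0 (is_derive_enorm i x0))); field.
(* For order 0 the last factor [(japanese x)^-1] counts as order 0, for a total of -1. In the next
   case all three count as order -1, for a total of -2. *)
- exists (fun x _ =>
      - 1 * x ord0 i * (japanese x)^-1 * (japanese x)^-1 * (japanese x)^-1).
    apply: (@symbol_mul_eq _ (- 1) 0) => //; last exact: symbol_japaneseV0.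
    apply: (@symbol_mul_eq _ 0 (- 1)) => //; last exact: symbol_japaneseV1.
    apply: (@symbol_mul_eq _ 1 (- 1)) => //; last exact: symbol_japaneseV1.
    exact: (@symbol_mul_eq _ 0 1 _ _ (symbol_cst _) (symbol_coord _)).
  by move=> x t _; exact: is_derive_japaneseV.
- exists (fun x _ =>
      - 1 * x ord0 i * (japanese x)^-1 * (japanese x)^-1 * (japanese x)^-1).
    apply: (@symbol_mul_eq _ (- 1) (- 1)) => //; last exact: symbol_japaneseV1.
    apply: (@symbol_mul_eq _ 0 (- 1)) => //; last exact: symbol_japaneseV1.
    apply: (@symbol_mul_eq _ 1 (- 1)) => //; last exact: symbol_japaneseV1.
    exact: (@symbol_mul_eq _ 0 1 _ _ (symbol_cst _) (symbol_coord _)).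
  by move=> x t _; exact: is_derive_japaneseV.
- exists (fun _ _ => 0); first exact: symbol_0.
  by move=> x t _; exact: is_derive_cst.
- move=> m f g _ [df sdf Df] _ [dg sdg Dg].
  exists (fun x t => df x t + dg x t); first exact: symbol_add.
  by move=> x t x0; apply: is_derive_add; [exact: Df|exact: Dg].
- move=> m1 m2 f g sf [df sdf Df] sg [dg sdg Dg].
  exists (fun x t => f x t * dg x t + g x t * df x t).
    apply: symbol_add.
      by apply: (symbol_mul_eq sf sdg); lia.
    by apply: (symbol_mul_eq sg sdf); lia.
  by move=> x t x0; apply: is_derive_mul; [exact: Df|exact: Dg].
Qed.

Lemma symbol_bound m f : symbol m f ->
  exists (C : R) (k : nat), 0 <= C /\ forall x t, x != 0 -> 0 < t ->
    `|f x t| <= C * (1 + enorm x ^+ 2 * t) ^+ k * enorm x ^ m.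
Proof.
have ge1 x t : 0 < t -> 1 <= 1 + enorm x ^+ 2 * t.
  by move=> t0; rewrite lerDl mulr_ge0// ?sqr_ge0// ltW.
elim=> {m f}.
- move=> m; exists 0, 0%N; split=> // x t _ _.
  by rewrite normr0 mul0r mul0r.
- move=> c; exists `|c|, 0%N; split=> // x t _ _.
  by rewrite expr0 expr0z !mulr1.
- move=> i; exists 1, 0%N; split=> // x t _ _.
  by rewrite expr0 expr1z !mul1r coord_le_enorm.
- exists 1, 0%N; split=> // x t _ _.
  by rewrite expr0 expr1z !mul1r ger0_norm// enorm_ge0.
- exists 1, 0%N; split=> // x t _ _.
  by rewrite expr0 !mul1r exprN1 ger0_norm// invr_ge0 enorm_ge0.
- exists 1, 0%N; split=> // x t _ _.
  rewrite expr0 expr0z !mulr1 ger0_norm ?invr_ge0 ?(ltW (japanese_gt0 x))//.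
  by rewrite invf_le1 ?japanese_gt0// japanese_ge1.
- exists 1, 0%N; split=> // x t x0 _.
  rewrite expr0 !mul1r exprN1 ger0_norm ?invr_ge0 ?(ltW (japanese_gt0 x))//.
  by rewrite lef_pV2 ?posrE ?japanese_gt0 ?enorm_gt0// enorm_le_japanese.
(* With r = |x|, t = (r^2 t) r^-2 <= (1 + r^2 t) r^-2: this is the source of the powers of 1 + r^2
   t. *)
- exists 1, 1%N; split=> // x t x0 t0.
  rewrite mul1r expr1 (gtr0_norm t0) -[- 2]/(- 2%:Z) -exprnN.
  by rewrite ler_pdivlMr ?exprn_gt0 ?enorm_gt0// mulrC lerDr ler01.
- move=> m f g _ [C [k [C0 fC]]] _ [D [l [D0 gD]]].
  (* The base 1 + r^2 t is at least 1, so both powers are bounded by the one with exponent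
     [k + l]. *)
  exists (C + D), (k + l)%N; split=> [|x t x0 t0]; first exact: addr_ge0.
  apply: le_trans (ler_normD _ _) _; rewrite !mulrDl lerD//.
    apply: le_trans (fC _ _ x0 t0) _; rewrite ler_wpM2r ?exprz_ge0 ?enorm_ge0//.
    by rewrite ler_wpM2l// ler_weXn2l ?ge1// leq_addr.
  apply: le_trans (gD _ _ x0 t0) _; rewrite ler_wpM2r ?exprz_ge0 ?enorm_ge0//.
  by rewrite ler_wpM2l// ler_weXn2l ?ge1// leq_addl.
- move=> m1 m2 f g _ [C [k [C0 fC]]] _ [D [l [D0 gD]]].
  exists (C * D), (k + l)%N; split=> [|x t x0 t0]; first exact: mulr_ge0.
  rewrite normrM expfzDr ?gt_eqF ?enorm_gt0// exprD.
  apply: le_trans (ler_pM _ _ (fC _ _ x0 t0) (gD _ _ x0 t0)) _ => //.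
  by rewrite le_eqVlt; apply/orP; left; apply/eqP; ring.
Qed.

(** * Exponential factors and their products with symbols *)

(* The exponents in the Green matrix, for [c = - 1] and [c = 1]. *)
Definition eigenvalue (c : R) x : R := - enorm x ^+ 2 - 1 + c * japanese x.

(** From (s - 1)^2 >= 0 and s^2 = 1 + r^2 follows 2s <= 2 + r^2. *)
Lemma eigenvalue_le c x : `|c| <= 1 -> eigenvalue c x <= - (enorm x ^+ 2 / 2).
Proof.
rewrite ler_norml => /andP[_ c1].
have j1 := japanese_ge1 x; have := japanese_sqr x.
rewrite /eigenvalue; nra.
Qed.

(** The spare factor e^(y/6), from 1/2 - 1/3 = 1/6, absorbs the polynomial: 1 + y <= K e^(y/K) for K
    >= 1, and the k-th power costs e^(ky/K) with k/K <= 1/6. *)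
Lemma polynomial_expR_bound (k : nat) : exists2 C : R, 0 < C &
  forall y : R, 0 <= y ->
    (1 + y) ^+ k * expR (- (y / 2)) <= C * expR (- (1 / 3 * y)).
Proof.
(* The successor keeps [K] at least 1 even when [k] is 0. *)
pose K : R := 6 * k.+1%:R; have K1 : 1 <= K by rewrite /K -natrM ler1n.
have K0 : 0 < K by exact: lt_le_trans K1.
exists (K ^+ k) => [|y y0]; first exact: exprn_gt0.
have -> : expR (- (1 / 3 * y)) = expR (y / 6) * expR (- (y / 2)).
  by rewrite -expRD; congr expR; field.
rewrite mulrA ler_wpM2r ?expR_ge0//.
have yK : 1 + y <= K * expR (y / K).
  apply: (@le_trans _ _ (K * (1 + y / K))); last first.
    by rewrite ler_wpM2l ?(ltW K0)// expR_ge1Dx.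
  by rewrite mulrDr mulr1 mulrCA divff ?gt_eqF// mulr1 lerD2r.
apply: (@le_trans _ _ ((K * expR (y / K)) ^+ k)).
  by rewrite lerXn2r// ?nnegrE ?mulr_ge0 ?expR_ge0 ?addr_ge0 ?(ltW K0).
rewrite exprMn ler_wpM2l ?exprn_ge0 ?(ltW K0)// -expRM_natl ler_expR.
rewrite /K mulrA ler_pdivrMr ?mulr_gt0//.
rewrite [leRHS](_ : _ = k.+1%:R * y); last by field.
by rewrite ler_wpM2r// ler_nat.
Qed.

Lemma symbol_exp_bound c m f : `|c| <= 1 -> symbol m f ->
  exists2 C, 0 < C & forall x t, x != 0 -> 0 < t ->
    `|expR (eigenvalue c x * t) * f x t|
      <= C * expR (- (1 / 3 * enorm x ^+ 2 * t)) * enorm x ^ m.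
Proof.
move=> c1 /symbol_bound[C [k [C0 fC]]].
have [D D0 kD] := polynomial_expR_bound k.
(* [C] may vanish; adding 1 makes the constant positive. *)
exists ((C + 1) * D) => [|x t x0 t0]; first by rewrite mulr_gt0// ltr_wpDl.
have y0 : 0 <= enorm x ^+ 2 * t by rewrite mulr_ge0 ?sqr_ge0// ltW.
rewrite normrM ger0_norm ?expR_ge0// mulrC.
apply: le_trans (ler_wpM2r (expR_ge0 _) (fC _ _ x0 t0)) _.
rewrite mulrAC ler_wpM2r ?exprz_ge0 ?enorm_ge0//.
rewrite -(mulrA (1 / 3)) -[leLHS]mulrA -[leRHS]mulrA.
apply: (@le_trans _ _ (C * (D * expR (- (1 / 3 * (enorm x ^+ 2 * t)))))).
  rewrite ler_wpM2l//; apply: le_trans (kD _ y0).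
  rewrite ler_wpM2l ?exprn_ge0 ?addr_ge0// ler_expR.
  have := eigenvalue_le x c1; nra.
by rewrite ler_wpM2r ?mulr_ge0 ?expR_ge0 ?lerDl// ltW.
Qed.

Lemma symbol_exp_derive c i m f : symbol m f ->
  exists2 g, symbol (m - 1) g & forall x t, x != 0 ->
    is_derive x (e_ i) (fun y => expR (eigenvalue c y * t) * f y t)
      (expR (eigenvalue c x * t) * g x t).
Proof.
move=> sf; have [df sdf Df] := symbol_derive i sf.
exists (fun x t => df x t +
  t * (- 2 * x ord0 i + c * (x ord0 i * (japanese x)^-1)) * f x t).
  apply: symbol_add => //.
  apply: (@symbol_mul_eq _ (- 1) m) => //; last by lia.
  apply: (@symbol_mul_eq _ (- 2) 1) => //; first exact: symbol_time.
  apply: symbol_add.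
    exact: (@symbol_mul_eq _ 0 1 _ _ (symbol_cst _) (symbol_coord _)).
  (* Here 1/s counts as order 0, so that both terms of d_i lambda have order 1. *)
  apply: (@symbol_mul_eq _ 0 1 _ _ (symbol_cst _)) => //.
  exact: (@symbol_mul_eq _ 1 0 _ _ (symbol_coord _) symbol_japaneseV0).
move=> x t x0.
have De : is_derive x (e_ i) (eigenvalue c) _ := is_derive_add
  (is_derive_add (is_deriveN (is_derive_enorm_sqr x i))
    (is_derive_cst (- 1 : R) x _))
  (is_derive_mul (is_derive_cst c x _) (is_derive_japanese x i)).
have D := is_derive_mul (is_derive_chain
  (g := fun y => eigenvalue c y * t) (is_derive_expR _)
  (is_derive_mul De (is_derive_cst t x _))) (Df x t x0).
by apply: (is_derive_eq D); rewrite /cst/=; ring.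
Qed.

(** Each exponential has its own coefficient of the common order, so no cancellation between the two
    is used. The identity is asked only off the origin, where the derivatives are controlled. *)
Definition exp_symbol m (F : 'rV[R]_n -> R -> R) :=
  exists f g, [/\ symbol m f, symbol m g & forall x t, x != 0 ->
    F x t = expR (eigenvalue (- 1) x * t) * f x t
          + expR (eigenvalue 1 x * t) * g x t].

Lemma exp_symbol_bound m F : exp_symbol m F ->
  exists2 C, 0 < C & forall x t, x != 0 -> 0 < t ->
    `|F x t| <= C * expR (- (1 / 3 * enorm x ^+ 2 * t)) * enorm x ^ m.
Proof.
move=> [f [g [sf sg FE]]].
have [||C C0 fC] := @symbol_exp_bound (- 1) m f; [by rewrite normrN1|by []|].
have [||D D0 gD] := @symbol_exp_bound 1 m g; [by rewrite normr1|by []|].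
exists (C + D) => [|x t x0 t0]; first exact: addr_gt0.
rewrite FE//; apply: le_trans (ler_normD _ _) _.
apply: le_trans (lerD (fC x t x0 t0) (gD x t x0 t0)) _.
by rewrite -mulrDl -mulrDl lexx.
Qed.

Lemma near_neq0 x : x != 0 -> \forall y \near x, y != 0.
Proof. exact: (@cvgr_neq0 R _ _ (nbhs x) (nbhs_filter x) id x cvg_id). Qed.

Lemma exp_symbol_derive i m F : exp_symbol m F ->
  exists2 G, exp_symbol (m - 1) G & forall x t, x != 0 ->
    is_derive x (e_ i) (F^~ t) (G x t).
Proof.
move=> [f [g [sf sg FE]]].
have [df sdf Df] := symbol_exp_derive (- 1) i sf.
have [dg sdg Dg] := symbol_exp_derive 1 i sg.
exists (fun x t => expR (eigenvalue (- 1) x * t) * df x t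
                 + expR (eigenvalue 1 x * t) * dg x t); first by exists df, dg.
move=> x t x0; have D := is_derive_add (Df x t x0) (Dg x t x0).
(* A derivative depends only on the germ at [x], and points near a nonzero [x] are nonzero. *)
apply: (near_eq_is_derive _ D); near=> y.
by rewrite FE//; near: y; exact: near_neq0.
Unshelve. all: by end_near. Qed.

(** Time comes first so that [partial] and [Dmulti] act on [F t]. *)
Definition mx_exp_symbol p q m (F : R -> 'rV[R]_n -> 'M[R]_(p, q)) :=
  forall (a : 'I_p) (b : 'I_q), exp_symbol m (fun x t => F t x a b).

Lemma eq_exp_symbol m F G : exp_symbol m F ->
  (forall x t, x != 0 -> G x t = F x t) -> exp_symbol m G.
Proof.
move=> [f [g [sf sg FE]]] GF; exists f, g; split=> // x t x0.
by rewrite GF// FE.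
Qed.

Lemma mx_exp_symbol_partial p q m k (F : R -> 'rV[R]_n -> 'M[R]_(p, q)) :
  mx_exp_symbol m F -> mx_exp_symbol (m - 1) (fun t => partial k (F t)).
Proof.
move=> sF a b; have [G sG FG] := exp_symbol_derive k (sF a b).
apply: eq_exp_symbol sG _ => x t x0.
rewrite /partial derive_mx; first by rewrite mxE; have [] := FG x t x0.
(* Entrywise differentiation by [derive_mx] requires the whole matrix to be derivable, hence every
   entry. *)
apply/derivable_mxP => c d.
by have [H _ FH] := exp_symbol_derive k (sF c d); have [] := FH x t x0.
Qed.

Lemma mx_exp_symbol_Dmulti p q m (alpha : multi_index n)
    (F : R -> 'rV[R]_n -> 'M[R]_(p, q)) :
  mx_exp_symbol m F ->
  mx_exp_symbol (m - (mi_order alpha)%:Z) (fun t => Dmulti alpha (F t)).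
Proof.
move=> sF; rewrite /mi_order /Dmulti -big_enum /=.
(* The outer induction runs over the coordinates, the inner one over the number of derivatives in
   one coordinate. *)
elim: (enum _) => [|k s IHs]; first by rewrite big_nil subr0.
rewrite big_cons /=; move: (\sum_(j <- s) alpha j)%N IHs => a IHs.
elim: (alpha k) => [|l IHl] //=.
have -> : m - (l.+1 + a)%:Z = m - (l + a)%:Z - 1 by lia.
exact: mx_exp_symbol_partial IHl.
Qed.

End Symbols.

(** * The Green matrix as a symbol of order 0 *)

Lemma mx_exp_symbol_Ghat (R : realType) :
  mx_exp_symbol 0 (fun t (x : 'rV[R]_3) => Ghat x t).
Proof.
pose half (c d : R) := (fun (x : 'rV[R]_3) (_ : R) => c + d * (japanese x)^-1).
have shalf c d : symbol 0 (half c d).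
  apply: symbol_add; first exact: symbol_cst.
  exact: (@symbol_mul_eq _ _ _ 0 0 _ _ (symbol_cst _ _) (symbol_japaneseV0 _ _)).
pose off (c : R) := (fun (x : 'rV[R]_3) (_ : R) => c * enorm x * (japanese x)^-1).
have soff c : symbol 0 (off c).
  (* The quotient r/s has order 0 because 1/s may count as order -1. *)
  apply: (@symbol_mul_eq _ _ _ 1 (- 1)) => //; last exact: symbol_japaneseV1.
  exact: (@symbol_mul_eq _ _ _ 0 1 _ _ (symbol_cst _ _) (symbol_enorm _ _)).
(* Spectral decomposition: with J = [Jmx x], J^2 = s^2 I, so (I + J/s)/2 and (I - J/s)/2 are the
   projections attached to the two exponents. *)
have GE (x : 'rV[R]_3) t a b : Ghat x t a b =
    expR (eigenvalue (- 1) x * t) * (((a == b)%:R + Jmx x a b * (japanese x)^-1) / 2)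
  + expR (eigenvalue 1 x * t) * (((a == b)%:R - Jmx x a b * (japanese x)^-1) / 2).
  rewrite /eigenvalue /Ghat /calA /calB -/(japanese x) !mxE.
  have -> : (- enorm x ^+ 2 - 1 + - 1 * japanese x) * t =
    - (enorm x ^+ 2 * t) + (- 1 - japanese x) * t by ring.
  have -> : (- enorm x ^+ 2 - 1 + 1 * japanese x) * t =
    - (enorm x ^+ 2 * t) + (- 1 + japanese x) * t by ring.
  rewrite !expRD; field.
  by rewrite gt_eqF// japanese_gt0.
move=> a b; have [eab|nab] := eqVneq a b.
  (* The diagonal entry of [Jmx], not the square root. *)
  pose s : R := if a == ord0 then - 1 else 1.
  exists (half 2^-1 (s / 2)), (half 2^-1 (- (s / 2))); split=> // x t _.
  rewrite GE !mxE -eab eqxx /half -/s /=; move: s => s.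
  by congr (_ * _ + _ * _); field; exact: lt0r_neq0 (japanese_gt0 x).
exists (off (- 2^-1)), (off 2^-1); split=> // x t _.
rewrite GE !mxE (negPf nab) /off /=; congr (_ * _ + _ * _); field;
by rewrite gt_eqF// japanese_gt0.
Qed.

Theorem lemma3p4 (R : realType) (alpha : multi_index 3) :
  exists C : R, 0 < C /\
    forall (xi : 'rV[R]_3) (t : R), xi != 0 -> 0 < t ->
      mnorm1 (Dmulti alpha (fun eta : 'rV[R]_3 => Ghat eta t) xi)
      <= C * expR (- (1 / 3 * enorm xi ^+ 2 * t)) * enorm xi ^- mi_order alpha.
Proof.
have sG := mx_exp_symbol_Dmulti alpha (@mx_exp_symbol_Ghat R).
(* One constant is chosen for each of the four entries; their sum serves for [mnorm1]. *)
have /choice[C HC] : forall ij : 'I_2 * 'I_2, exists C : R, 0 < C /\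
    forall (xi : 'rV[R]_3) (t : R), xi != 0 -> 0 < t ->
      `|Dmulti alpha (fun eta : 'rV[R]_3 => Ghat eta t) xi ij.1 ij.2|
      <= C * expR (- (1 / 3 * enorm xi ^+ 2 * t)) * enorm xi ^- mi_order alpha.
  move=> [i j]; have [C C0 HC] := exp_symbol_bound (sG i j).
  by exists C; split=> // xi t x0 t0; have := HC xi t x0 t0; rewrite sub0r -exprnN.
have C0 ij : 0 < C ij by have [] := HC ij.
exists (\sum_(i < 2) \sum_(j < 2) C (i, j)); split=> [|xi t x0 t0].
  by rewrite !big_ord_recl !big_ord0 !addr0 !addr_gt0.
rewrite /mnorm1 !mulr_suml ler_sum// => i _; rewrite !mulr_suml ler_sum// => j _.
by have [_] := HC (i, j); exact.
Qed.
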